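(* Consider the following two sets of conditions. (U1) $A(s)$ is compact for every $s\in S$ and the correspondence $s\mapsto A(s)$ is upper semicontinuous; (U2) $u$ is upper semicontinuous on $\mathbb K$; (U3) $q$ is Feller, i.e. $(s,a)\mapsto\int_S v(s')q(ds'|s,a)$ is continuous on $\mathbb K$ for each bounded continuous $v:S\to\mathbb R$. (C1) $A(s)$ is compact for every $s\in S$ and the correspondence $s\mapsto A(s)$ is continuous; (C2) $u$ is continuous on $\mathbb K$; (C3) the same as (U3). Assume that (U1)-(U3) hold or that (C1)-(C3) hold. Then there exists an optimal stationary policy $f^*\in\Phi$ and $$U(f^* )(s)=\mathcal T U(f^* )(s)=\mathcal T_{f^*}U(f^* )(s)=H(s,f^*(s),U(f^* ))\quad\text{for all } s\in S.$$ If (U1)-(U3) hold, then $U(f^* )\in\widehat{\mathcal U}$; if (C1)-(C3) hold, then $U(f^* )\in\widehat{\mathcal C}$.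
   Context: Model. $S$ (states) and $A$ (actions) are Borel spaces, i.e. non-empty Borel subsets of complete separable metric spaces. $\mathbb K\subset S\times A$ is a non-empty Borel set such that each section $A(s)=\{a\in A:(s,a)\in\mathbb K\}$, $s\in S$, is non-empty. $q$ is a Borel measurable transition probability from $\mathbb K$ to $S$. $u:\mathbb K\to\mathbb R$ is Borel measurable with $b_0\le u(s,a)\le b_1$ for all $(s,a)\in\mathbb K$, where $b_1>b_0>0$ are constants. $\beta\in[0,1)$, $r<0$, and $p<1$, $p\ne0$ are fixed real parameters. Constants and classes. $0<\epsilon<B$ are fixed constants chosen as follows: if $p<0$, then $\epsilon\le b_0$ and $B\ge(1-\beta)^{1/p}b_1$; if $p\in(0,1)$, then $\epsilon\le(1-\beta)^{1/p}b_0$ and $B\ge b_1$. $\widehat{\mathcal U}$ (resp. $\widehat{\mathcal C}$) is the set of all upper semicontinuous (resp. continuous) functions $v:S\to[\epsilon,B]$. Operators. $M(v)(s,a)=\frac1r\ln\int_S e^{rv(s')}q(ds'|s,a)$, $H(s,a,v)=[(1-\beta)u(s,a)^p+\beta(M(v)(s,a))^p]^{1/p}$, $\mathcal T_fv(s)=H(s,f(s),v)$, $\mathcal Tv(s)=\sup_{a\in A(s)}H(s,a,v)$. Policies. A policy $\pi=(\pi_n)_{n\ge1}\in\Pi$ is a sequence of Borel measurable maps with $\pi_n(h_n)\in A(s_n)$ for every history $h_n=(s_1,a_1,\dots,s_{n-1},a_{n-1},s_n)$ ($h_1=s_1$). $\Phi$ is the set of Borel measurable $f:S\to A$ with $f(s)\in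 A(s)$ for all $s$; $f\in\Phi$ is identified with the stationary policy $(f,f,\dots)$. Recursive utility. For $\pi\in\Pi$ and $n\ge1$ let $V_{n,n}(h_n)=(1-\beta)^{1/p}u(s_n,\pi_n(h_n))$ and, for $k=n-1,\dots,1$, with $a_k=\pi_k(h_k)$, $$V_{k,n}(h_k)=\left[(1-\beta)u(s_k,a_k)^p+\beta\left(\frac1r\ln\int_S e^{rV_{k+1,n}(h_k,a_k,s')}q(ds'|s_k,a_k)\right)^p\right]^{1/p}.$$ Put $U_n(\pi)(s_1)=V_{1,n}(s_1)$ and $U(\pi)(s_1)=\lim_{n\to\infty}U_n(\pi)(s_1)$ (the sequence is monotone and bounded). A policy $\pi^*$ is optimal if $U(\pi^* )(s)\ge U(\pi)(s)$ for all $\pi\in\Pi$ and $s\in S$. A correspondence $\varphi$ from $S$ to a separable metric space $Z$ is upper (lower) semicontinuous if $\{s\in S:\varphi(s)\cap D\ne\emptyset\}$ is closed (open) for each closed (open) $D\subset Z$, and continuous if both. *)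

(* Defs.v *)
From HB Require Import structures.
From mathcomp Require Import all_boot all_order all_algebra.
From mathcomp Require Import all_classical all_reals all_analysis.
From mathcomp Require Import measurable_realfun.

Set Implicit Arguments.
Unset Strict Implicit.
Unset Printing Implicit Defensive.

Import Order.TTheory GRing.Theory Num.Theory.
Import numFieldNormedType.Exports.

Local Open Scope classical_set_scope.
Local Open Scope ring_scope.

(* The product topology on a product of pointed spaces; the library only
   provides it as a [topologicalType]. *)
HB.instance Definition _ (X Y : ptopologicalType) := Topological.on (X * Y)%type.

Notation borelT T := (g_sigma_algebraType (@open T)).

Definition complete_space (X : uniformType) : Prop :=
  forall F : set_system X, ProperFilter F -> cauchy F -> exists x : X, F --> x.

Definition separable_space (X : topologicalType) : Prop :=
  exists D : set X, countable D /\ dense D.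

(* [T] is, through [i], a Borel subset of a complete separable metric space,
   equipped with the relative topology; [T] is nonempty because pointed. *)
Definition borel_space (R : realType) (T : ptopologicalType) : Prop :=
  exists (X : metricType R) (i : T -> X),
    [/\ complete_space X,
        separable_space X,
        injective i,
        (forall U : set T,
           open U <-> exists2 V : set X, open V & U = i @^-1` V)
      & <<s @open X >> (range i)].

Section correspondences.
Context (S Z : topologicalType).

Definition usc_corr (phi : S -> set Z) : Prop :=
  forall D : set Z, closed D -> closed [set s | phi s `&` D !=set0].

Definition lsc_corr (phi : S -> set Z) : Prop :=
  forall D : set Z, open D -> open [set s | phi s `&` D !=set0].

Definition continuous_corr (phi : S -> set Z) : Prop :=
  usc_corr phi /\ lsc_corr phi.

End correspondences.

(* Upper semicontinuity of the restriction of [f] to [D]. *)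
Definition usc_on (R : realType) (T : topologicalType) (D : set T)
    (f : T -> R) : Prop :=
  forall x c, D x -> f x < c -> \forall y \near within D (nbhs x), f y < c.

Section model.
Context (R : realType) (S A : ptopologicalType).

(* [u] and [q] are total functions on [S * A]; only their values on [K] are
   constrained and used. *)
Context (K : set (S * A)) (q : S * A -> probability (borelT S) R)
  (u : S * A -> R) (beta r p : R).

Definition section_of (s : S) : set A := [set a | K (s, a)].

Definition transition_probability : Prop :=
  forall D : set (borelT S), measurable D ->
    measurable_fun (K : set (borelT (S * A)%type))
      (fun x => q x D : \bar R).

Definition feller : Prop :=
  forall v : S -> R, continuous v -> (exists M, forall s, `|v s| <= M) ->
    {within K, continuous (fun x => \int[q x]_s v s)}.

Definition aggregator (x y : R) : R :=
  ((1 - beta) * x `^ p + beta * y `^ p) `^ p^-1.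

Definition Mop (v : S -> R) (x : S * A) : R :=
  r^-1 * ln (\int[q x]_s expR (r * v s)).

Definition Hop (s : S) (a : A) (v : S -> R) : R :=
  aggregator (u (s, a)) (Mop v (s, a)).

Definition Tsel (f : S -> A) (v : S -> R) (s : S) : R := Hop s (f s) v.

Definition Top (v : S -> R) (s : S) : R :=
  sup [set Hop s a v | a in section_of s].

(* Histories are indexed from 0: [hist n] is (S * A)^n * S, and an element of
   [hist n] is a history with current state number n + 1. *)
Fixpoint hist (n : nat) : ptopologicalType :=
  if n is m.+1 then (hist m * A * S)%type else S.

Definition current (n : nat) : hist n -> S :=
  match n return hist n -> S with
  | 0 => fun s => s
  | m.+1 => fun h : hist m * A * S => h.2
  end.

(* The set K^n * S of histories that can actually occur. *)
Fixpoint admissible (n : nat) : set (hist n) :=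
  match n return set (hist n) with
  | 0 => setT
  | m.+1 => [set h : hist m * A * S |
               admissible h.1.1 /\ K (current h.1.1, h.1.2)]
  end.

Definition is_policy (pi : forall n, hist n -> A) : Prop :=
  forall n,
    measurable_fun (@admissible n : set (borelT (hist n)))
      (pi n : borelT (hist n) -> borelT A) /\
    (forall h, admissible h -> section_of (current h) (pi n h)).

Definition is_selector (f : S -> A) : Prop :=
  measurable_fun setT (f : borelT S -> borelT A) /\
  (forall s, section_of s (f s)).

Definition stationary (f : S -> A) : forall n, hist n -> A :=
  fun n h => f (current h).

(* [Vrec pi d k] is the function V_{k+1,k+1+d} of the backward recursion:
   [d] stages remain after the current one. *)
Fixpoint Vrec (pi : forall n, hist n -> A) (d k : nat) : hist k -> R :=
  if d is d'.+1 then
    fun h => Hop (current h) (pi k h)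
               (fun s' => Vrec pi d' ((h, pi k h, s') : hist k.+1))
  else fun h => (1 - beta) `^ p^-1 * u (current h, pi k h).

(* Meaningful for [n >= 1]. *)
Definition Un (pi : forall n, hist n -> A) (n : nat) (s : S) : R :=
  @Vrec pi n.-1 0 s.

Definition utility (pi : forall n, hist n -> A) (s : S) : R :=
  limn (fun n => Un pi n s).

Definition optimal (pi : forall n, hist n -> A) : Prop :=
  is_policy pi /\
  forall pi', is_policy pi' -> forall s, utility pi' s <= utility pi s.

Definition condU : Prop :=
  [/\ (forall s, compact (section_of s)) /\ usc_corr section_of,
      usc_on K u
    & feller].

Definition condC : Prop :=
  [/\ (forall s, compact (section_of s)) /\ continuous_corr section_of,
      {within K, continuous u}
    & feller].

End model.

Definition classU (R : realType) (S : topologicalType) (eps B : R) :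
    set (S -> R) :=
  [set v | (forall s, eps <= v s <= B) /\ usc_on setT v].

Definition classC (R : realType) (S : topologicalType) (eps B : R) :
    set (S -> R) :=
  [set v | (forall s, eps <= v s <= B) /\ continuous v].

(* Main.v *)
Require Import Defs.
From mathcomp Require Import all_boot all_order all_algebra.
From mathcomp Require Import all_classical all_reals all_analysis.
From mathcomp Require Import measurable_realfun.
From mathcomp Require Import ring lra.
Import Order.TTheory GRing.Theory Num.Theory.
Import numFieldNormedType.Exports.
Local Open Scope classical_set_scope.
Local Open Scope ring_scope.

Set Implicit Arguments.
Unset Strict Implicit.
Unset Printing Implicit Defensive.

(* The Bellman operator [Top] is a contraction for ratios of functions. By
   Jensen's inequality the certainty equivalent [Mop] satisfies
   [Mop (l v) <= l * Mop v] for [l >= 1]; and the aggregator is concave in its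
   second argument, with an elasticity bounded by some [k < 1] as long as
   utilities stay in [eps, B]. Hence [v <= l w] implies
   [Top v <= (1 + k (l - 1)) Top w]. The iterates of [Top] from the constant [B]
   therefore decrease, at a uniform rate in ratio, to a fixed point, the value
   function, which is upper semicontinuous as an infimum of such functions (the
   Feller property passes to lower semicontinuous integrands, which are
   increasing limits of Lipschitz ones). A Borel maximizer is selected by
   maximizing over [A(s)] first the Bellman objective and then, one after the
   other, countably many continuous functions separating the points of [A].

   The same ratio estimate compares the utility of any policy with the value
   function. It needs [Mop] to be monotone, not the measurability of the utilities
   [V_{k,n}] of a history-dependent policy: the integral of a nonnegative function
   is a lower integral, and in [v <= l w] it suffices that one of the two functions
   be measurable, which the value function is. *)

(** * The aggregator *)

Section aggregator.
Context {R : realType}.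
Implicit Types x y l t p beta : R.

(** Convexity of [expR] between 0 and [y]. With [m = t * y], the tangent bound at [- m] and at
    [y - m], averaged with weights [1 - t] and [t], loses its linear terms. *)
Lemma expR_weighted_amgm t y : 0 <= t <= 1 ->
  expR (t * y) <= 1 - t + t * expR y.
Proof.
move=> /andP[t0 t1]; set m := t * y.
have e1 : 1 - m <= expR (- m) by exact: expR_ge1Dx.
have e2 : 1 + (y - m) <= expR (y - m) by exact: expR_ge1Dx.
rewrite -(ler_pM2l (expR_gt0 (- m))) -expRD addNr expR0.
rewrite mulrDr mulrCA -expRD [- m + y]addrC.
have h1 : (1 - t) * (1 - m) <= (1 - t) * expR (- m).
  by rewrite ler_wpM2l// subr_ge0.
have h2 : t * (1 + (y - m)) <= t * expR (y - m) by rewrite ler_wpM2l.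
have -> : expR (- m) * (1 - t) = (1 - t) * expR (- m) by rewrite mulrC.
rewrite (le_trans _ (lerD h1 h2))// le_eqVlt; apply/orP; left; apply/eqP.
by rewrite /m; ring.
Qed.

(** Bernoulli's inequality for [expR y]; it is the preceding convexity bound with weight [l^-1] at
    the point [l * y]. *)
Lemma expR_bernoulli l y : 1 <= l -> 1 + l * (expR y - 1) <= expR (l * y).
Proof.
move=> l1; have l0 : 0 < l by rewrite (lt_le_trans ltr01).
have := @expR_weighted_amgm l^-1 (l * y).
rewrite invr_ge0 (ltW l0) invf_le1// l1 => /(_ isT).
rewrite mulKf ?gt_eqF// -(ler_pM2l l0) mulrDr mulrBr mulVKf ?gt_eqF//.
by rewrite divff ?gt_eqF//; lra.
Qed.

Lemma le0_ler_powR p x y : p <= 0 -> 0 < x -> x <= y -> y `^ p <= x `^ p.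
Proof.
move=> p0 x0 xy; have y0 := lt_le_trans x0 xy.
by rewrite /powR !gt_eqF// ler_expR ler_wnM2l// ler_ln.
Qed.

(** For [p > 0], a concave power lies below its tangent at the arithmetic mean [m]. For [p < 0], the
    geometric mean of 1 and [l] separates the two sides. *)
Lemma power_mean_le_arith p t l : p < 1 -> p <> 0 -> 0 <= t <= 1 -> 0 < l ->
  (1 - t + t * l `^ p) `^ p^-1 <= 1 + t * (l - 1).
Proof.
move=> p1 p0 /andP[t0 t1] l0.
have powE z q : 0 < z -> z `^ q = expR (q * ln z).
  by move=> z0; rewrite /powR gt_eqF.
have m0 : 0 < 1 + t * (l - 1) by nra.
have lp0 := powR_gt0 p l0.
have s0 : 0 < 1 - t + t * l `^ p by nra.
have [pp|pn|/esym//] := ltgtP 0 p.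
- set m := 1 + t * (l - 1) in m0 *.
  have mp0 := powR_gt0 p m0.
  (* Bernoulli at [1 / m] and [l / m], averaged with weights [1 - t] and [t] *)
  have bern z : 0 < z -> z `^ p <= m `^ p * (1 - p + p * (z / m)).
    move=> z0; have -> : z `^ p = m `^ p * expR (p * (ln z - ln m)).
      by rewrite !powE// -expRD; congr expR; ring.
    rewrite ler_pM2l// (le_trans (expR_weighted_amgm _ _))//.
      by rewrite !ltW.
    by rewrite expRB !lnK.
  have sm : 1 - t + t * l `^ p <= m `^ p.
    have b1 := bern 1 ltr01; have bl := bern l l0; rewrite powR1 in b1.
    have -> : m `^ p = (1 - t) * (m `^ p * (1 - p + p * (1 / m))) +
        t * (m `^ p * (1 - p + p * (l / m))).
      have mm : m / m = 1 by rewrite divff// gt_eqF.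
      rewrite -[LHS]mulr1 -[in LHS](_ : 1 - p + p * (m / m) = 1); last first.
        by rewrite mm; ring.
      by rewrite {2}/m; ring.
    by rewrite lerD ?ler_wpM2l// -[leLHS]mulr1 ler_wpM2l// subr_ge0.
  have -> : m = (m `^ p) `^ p^-1.
    by rewrite -powRrM mulfV ?lt0r_neq0// powRr1// ltW.
  apply: ge0_ler_powR => //; rewrite ?nnegrE ?invr_ge0 ?powR_ge0 ?(ltW pp)//.
  exact: ltW.
- have am : expR (t * (p * ln l)) <= 1 - t + t * l `^ p.
    by rewrite powE// expR_weighted_amgm// t0.
  have ip0 : p^-1 <= 0 by rewrite invr_le0 ltW.
  rewrite (le_trans (le0_ler_powR ip0 (expR_gt0 _) am))//.
  rewrite powE ?expR_gt0// expRK mulrCA mulKf ?ltr0_neq0//.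
  rewrite (le_trans (expR_weighted_amgm _ _)) ?t0// lnK//.
  by rewrite le_eqVlt; apply/orP; left; apply/eqP; ring.
Qed.

(** Powers are monotone in a direction that depends on the sign of [p]; the min and the max absorb
    this case distinction. *)
Lemma powR_minmax p a b x : 0 < a -> a <= x <= b ->
  Num.min (a `^ p) (b `^ p) <= x `^ p <= Num.max (a `^ p) (b `^ p).
Proof.
move=> a0 /andP[ax xb]; have x0 := lt_le_trans a0 ax.
have b0 := lt_le_trans x0 xb.
rewrite ge_min le_max; have [p0|/ltW p0] := leP 0 p.
  by apply/andP; split; apply/orP; [left|right];
    apply: ge0_ler_powR; rewrite ?nnegrE// ltW.
by apply/andP; split; apply/orP; [right|left]; exact: le0_ler_powR.
Qed.

Section with_parameters.
Context (beta p : R).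
Hypotheses (beta_bounds : 0 <= beta < 1) (p_lt1 : p < 1) (p_neq0 : p <> 0).
Local Notation agg := (aggregator beta p).

Let sum_gt0 x y : 0 < x -> 0 < y -> 0 < (1 - beta) * x `^ p + beta * y `^ p.
Proof.
case/andP: beta_bounds => b0 b1 x0 y0.
by rewrite ltr_wpDr ?mulr_gt0 ?mulr_ge0 ?powR_ge0 ?powR_gt0 ?subr_gt0.
Qed.

Lemma aggregator_le x x' y y' : 0 < x -> x <= x' -> 0 < y -> y <= y' ->
  agg x y <= agg x' y'.
Proof.
case/andP: beta_bounds => b0 b1 x0 xx y0 yy.
have x0' := lt_le_trans x0 xx; have y0' := lt_le_trans y0 yy.
have b1' : 0 <= 1 - beta by rewrite subr_ge0 ltW.
rewrite /aggregator; have [pp|pn|/esym//] := ltgtP 0 p.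
  have pow_le z w : 0 < z -> z <= w -> z `^ p <= w `^ p.
    move=> z0 zw; apply: ge0_ler_powR; rewrite ?nnegrE ?(ltW pp) ?(ltW z0)//.
    exact: le_trans (ltW z0) zw.
  apply: ge0_ler_powR; rewrite ?nnegrE ?invr_ge0 ?(ltW pp)//.
  - by rewrite ltW ?sum_gt0.
  - by rewrite ltW ?sum_gt0.
  - by rewrite lerD// ler_wpM2l// pow_le.
apply: le0_ler_powR; rewrite ?invr_le0 ?(ltW pn)//; first exact: sum_gt0.
by rewrite lerD// ler_wpM2l// le0_ler_powR// ltW.
Qed.

Lemma aggregator_diag x : 0 < x -> agg x x = x.
Proof.
move=> x0; rewrite /aggregator -mulrDl subrK mul1r -powRrM mulfV ?powRr1 ?ltW//.
exact/eqP.
Qed.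

Lemma aggregator_bounds a b x y : 0 < a -> a <= x <= b -> a <= y <= b ->
  a <= agg x y <= b.
Proof.
move=> a0 /andP[ax xb] /andP[ay yb].
have b0 : 0 < b by exact: (lt_le_trans a0 (le_trans ax xb)).
apply/andP; split.
  by rewrite -[leLHS](aggregator_diag a0) aggregator_le.
by rewrite -[leRHS](aggregator_diag b0) aggregator_le// (lt_le_trans a0).
Qed.

(* The aggregator is concave in its second argument, and the elasticity of that
   argument, [beta y^p / ((1 - beta) x^p + beta y^p)], stays away from 1. *)
Lemma aggregator_subhomogeneous a b c d : 0 < a -> 0 < c ->
  exists2 k, 0 <= k < 1 & forall x y l, a <= x <= b -> c <= y <= d -> 1 <= l ->
    agg x (l * y) <= (1 + k * (l - 1)) * agg x y.
Proof.
move=> a0 c0; case/andP: beta_bounds => b0 b1.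
have b1' : 0 < 1 - beta by rewrite subr_gt0.
(* If one of the two ranges is empty, [k = 0] works vacuously. *)
have [ab|ba] := leP a b; last first.
  by exists 0; rewrite ?lexx ?ltr01// => x y l /andP[/le_trans h /h]; lra.
have [cd|dc] := leP c d; last first.
  by exists 0; rewrite ?lexx ?ltr01// => x y l _ /andP[/le_trans h /h]; lra.
(* [P0] bounds the first summand from below and [Q0] the second from above, so [Q0 / (P0 + Q0)]
   dominates the elasticity [t] at every point. *)
set P0 := (1 - beta) * Num.min (a `^ p) (b `^ p).
set Q0 := beta * Num.max (c `^ p) (d `^ p).
have P00 : 0 < P0.
  by rewrite mulr_gt0// lt_min !powR_gt0// (lt_le_trans a0).
have Q00 : 0 <= Q0.
  by rewrite mulr_ge0// le_max powR_ge0.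
have S0 : 0 < P0 + Q0 by rewrite ltr_wpDr.
exists (Q0 / (P0 + Q0)).
  by rewrite divr_ge0 ?(ltW S0)//= ltr_pdivrMr// mul1r ltrDr.
move=> x y l abx cdy l1.
have x0 : 0 < x by case/andP: abx => /(lt_le_trans a0).
have y0 : 0 < y by case/andP: cdy => /(lt_le_trans c0).
have l0 : 0 < l := lt_le_trans ltr01 l1.
have := powR_minmax p a0 abx; have := powR_minmax p c0 cdy.
move=> /andP[_ yQ] /andP[xP _].
set P := (1 - beta) * x `^ p; set Q := beta * y `^ p.
have PP : P0 <= P by rewrite ler_wpM2l// ltW.
have QQ : Q <= Q0 by rewrite ler_wpM2l.
have Q_ge0 : 0 <= Q by rewrite mulr_ge0// powR_ge0.
have G0 : 0 < P + Q by exact: sum_gt0.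
set t := Q / (P + Q).
have t0 : 0 <= t by rewrite divr_ge0// ltW.
have t1 : t <= 1 by rewrite ler_pdivrMr// mul1r lerDr (le_trans _ PP)// ltW.
have tk : t <= Q0 / (P0 + Q0).
  rewrite ler_pdivrMr// mulrAC ler_pdivlMr//.
  have := ler_pM Q_ge0 (ltW P00) QQ PP; rewrite !mulrDr [Q * Q0]mulrC.
  by rewrite lerD2r.
(* Factoring out [P + Q] leaves the power mean of 1 and [l] with weight [t] on [l]. *)
have -> : agg x (l * y) = (1 - t + t * l `^ p) `^ p^-1 * agg x y.
  have s0 : 0 <= 1 - t + t * l `^ p.
    by rewrite addr_ge0 ?subr_ge0// mulr_ge0 ?powR_ge0.
  rewrite /aggregator powRM ?(ltW l0) ?(ltW y0)// -/P -/Q.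
  rewrite -[RHS]powRM ?s0 ?(ltW G0)//.
  congr (_ `^ _); rewrite mulrA [beta * _]mulrC -mulrA -/Q /t.
  by field; rewrite gt_eqF.
rewrite ler_wpM2r ?powR_ge0//.
rewrite (le_trans (power_mean_le_arith p_lt1 p_neq0 _ l0)) ?t0//.
by rewrite lerD2l ler_wpM2r// subr_ge0.
Qed.

Lemma cvg_powR {T} (F : set_system T) {FF : Filter F} (f : T -> R) x q : 0 < x ->
  f @ F --> x -> f z `^ q @[z --> F] --> x `^ q.
Proof.
move=> x0 fx; rewrite {2}/powR gt_eqF//.
apply: (@cvg_trans _ (expR (q * ln (f z)) @[z --> F])).
  apply: near_eq_cvg; near=> z; rewrite /powR gt_eqF//.
  by near: z; exact: (cvgr_gt x).
apply: continuous_cvg; first exact: continuous_expR.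
by apply: cvgMr; apply: continuous_cvg => //; exact: continuous_ln.
Unshelve. all: by end_near. Qed.

Lemma cvg_aggregator {T} (F : set_system T) {FF : Filter F} (f g : T -> R) x y :
  0 < x -> 0 < y -> f @ F --> x -> g @ F --> y ->
  agg (f z) (g z) @[z --> F] --> agg x y.
Proof.
move=> x0 y0 fx gy; apply: cvg_powR; first exact: sum_gt0.
by apply: cvgD; apply: cvgMr; exact: cvg_powR.
Qed.

End with_parameters.
End aggregator.

(** * Integration and certainty equivalents *)

Section borel.
Context {R : realType} {T : ptopologicalType}.

Lemma open_borel (U : set T) : open U -> measurable (U : set (borelT T)).
Proof. by move=> oU; exact: sub_sigma_algebra. Qed.

Lemma closed_borel (D : set T) : closed D -> measurable (D : set (borelT T)).
Proof.
move=> cD; rewrite -[D]setCK; apply: measurableC; apply: open_borel.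
exact: closed_openC.
Qed.

Lemma usc_borel (f : T -> R) : usc_on setT f ->
  measurable_fun setT (f : borelT T -> R).
Proof.
move=> uf; apply: (measurability _ (RGenInftyO.measurableE R)).
move=> _ [_ [c ->] <-]; rewrite setTI; apply: open_borel.
rewrite openE => x; rewrite /= in_itv/= => fxc.
have := uf x c I fxc; rewrite near_withinE /interior.
by apply: filterS => y /(_ I); rewrite /= in_itv.
Qed.

Lemma continuous_usc_on (D : set T) (f : T -> R) :
  {within D, continuous f} -> usc_on D f.
Proof.
move=> /subspace_continuousP cf x c Dx fxc.
exact: (cvgr_lt (f x) (cf x Dx)).
Qed.

Lemma continuous_borel (f : T -> R) : continuous f ->
  measurable_fun setT (f : borelT T -> R).
Proof.
move=> cf; apply: usc_borel; apply: continuous_usc_on.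
exact: continuous_subspaceT.
Qed.

End borel.

Section integrals.
Context {R : realType} {d : measure_display} {T : measurableType d}.

(* The integral of a nonnegative function is a lower integral, hence monotone
   even on functions that are not measurable. *)
Lemma ge0_le_integral_pointwise (mu : {measure set T -> \bar R})
    (f g : T -> \bar R) : (forall x, 0 <= f x)%E -> (forall x, f x <= g x)%E ->
  (\int[mu]_x f x <= \int[mu]_x g x)%E.
Proof.
move=> f0 fg; rewrite !ge0_integralTE//; last first.
  by move=> x; rewrite (le_trans (f0 x)).
apply: ge_ereal_sup => _ [h hf <-]; apply: ereal_sup_ubound; exists h => //= x.
by rewrite (le_trans (hf x)).
Qed.

Section probability.
Context (mu : probability T R).

Lemma Rintegral_probability_cst c : \int[mu]_x c = c.
Proof. by rewrite Rintegral_cst//= probability_setT mulr1. Qed.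

Lemma ge0_bounded_integral_fin_num (f : T -> R) c : (forall x, 0 <= f x <= c) ->
  (\int[mu]_x (f x)%:E)%E \is a fin_num.
Proof.
move=> fb; rewrite ge0_fin_numE; last first.
  by apply: integral_ge0 => x _; rewrite lee_fin; case/andP: (fb x).
apply: (@le_lt_trans _ _ (\int[mu]_x (cst c%:E x))%E).
  by apply: ge0_le_integral_pointwise => x; rewrite lee_fin; case/andP: (fb x).
by rewrite integral_cst//= probability_setT mule1 ltry.
Qed.

Lemma ge0_le_Rintegral (f g : T -> R) c : (forall x, 0 <= f x) ->
  (forall x, f x <= g x) -> (forall x, g x <= c) ->
  \int[mu]_x f x <= \int[mu]_x g x.
Proof.
move=> f0 fg gc; apply: fine_le.
- by apply: (@ge0_bounded_integral_fin_num _ c) => x; rewrite f0 (le_trans (fg x)).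
- apply: (@ge0_bounded_integral_fin_num _ c) => x.
  by rewrite gc (le_trans (f0 x)).
- by apply: ge0_le_integral_pointwise => x; rewrite lee_fin.
Qed.

Lemma bounded_integrable (f : T -> R) c : measurable_fun setT f ->
  (forall x, `|f x| <= c) -> mu.-integrable setT (EFin \o f).
Proof.
move=> mf fc; apply: measurable_bounded_integrable => //.
  by rewrite ltey_eq fin_num_measure.
exists c; split; first exact: num_real.
by move=> z cz x _ /=; rewrite (le_trans (fc x))// ltW.
Qed.

End probability.
End integrals.

Section certainty_equivalent.
Context {R : realType} {S A : ptopologicalType}.
Context (q : S * A -> probability (borelT S) R) (r : R).
Hypothesis r_lt0 : r < 0.
Local Notation M := (Mop q r).
Implicit Types (v w : S -> R) (x : S * A) (c d l : R).

Lemma exp_integral_bounds v c d x : (forall s, c <= v s <= d) ->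
  expR (r * d) <= \int[q x]_s expR (r * v s) <= expR (r * c).
Proof.
move=> vcd; rewrite -{1}(Rintegral_probability_cst (q x) (expR (r * d))).
rewrite -(Rintegral_probability_cst (q x) (expR (r * c))).
have e1 s : expR (r * d) <= expR (r * v s).
  by rewrite ler_expR ler_nM2l//; case/andP: (vcd s).
have e2 s : expR (r * v s) <= expR (r * c).
  by rewrite ler_expR ler_nM2l//; case/andP: (vcd s).
apply/andP; split.
  by apply: (@ge0_le_Rintegral _ _ _ _ _ _ (expR (r * c))) => // s; rewrite expR_ge0.
by apply: (@ge0_le_Rintegral _ _ _ _ _ _ (expR (r * c))) => // s; rewrite expR_ge0.
Qed.

Lemma exp_integral_gt0 v c d x : (forall s, c <= v s <= d) ->
  0 < \int[q x]_s expR (r * v s).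
Proof.
by move=> /exp_integral_bounds-/(_ x)/andP[+ _]; apply: lt_le_trans; exact: expR_gt0.
Qed.

(** Since [r < 0], passing to the exponential integral reverses the order: upper semicontinuity of
    [Mop] becomes lower semicontinuity of that integral. *)
Lemma Mop_ltP v c d x t : (forall s, c <= v s <= d) ->
  (M v x < t) = (expR (r * t) < \int[q x]_s expR (r * v s)).
Proof.
move=> vcd; have I0 := exp_integral_gt0 x vcd.
by rewrite /Mop -(ltr_nM2l r_lt0) mulVKf ?ltr0_neq0// -[LHS]ltr_expR lnK.
Qed.

Lemma Mop_geP v c d x t : (forall s, c <= v s <= d) ->
  (t <= M v x) = (\int[q x]_s expR (r * v s) <= expR (r * t)).
Proof. by move=> vcd; rewrite leNgt (Mop_ltP _ _ vcd) -leNgt. Qed.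

Lemma Mop_expK v c d x : (forall s, c <= v s <= d) ->
  expR (r * M v x) = \int[q x]_s expR (r * v s).
Proof.
by move=> vcd; rewrite /Mop mulVKf ?ltr0_neq0// lnK// posrE (exp_integral_gt0 x vcd).
Qed.

Lemma Mop_le v w c d x : (forall s, c <= v s <= d) -> (forall s, c <= w s <= d) ->
  (forall s, v s <= w s) -> M v x <= M w x.
Proof.
move=> vcd wcd vw; rewrite (Mop_geP _ _ wcd) (Mop_expK x vcd).
apply: (@ge0_le_Rintegral _ _ _ _ _ _ (expR (r * c))) => s; rewrite ?expR_ge0//.
  by rewrite ler_expR ler_nM2l.
by rewrite ler_expR ler_nM2l//; case/andP: (vcd s).
Qed.

Lemma Mop_bounds v c d x : (forall s, c <= v s <= d) -> c <= M v x <= d.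
Proof.
move=> vcd; have /andP[Id Ic] := exp_integral_bounds x vcd.
by rewrite (Mop_geP _ _ vcd) Ic -(ler_nM2l r_lt0) -ler_expR (Mop_expK x vcd).
Qed.

(* Tangent line to [y |-> y^l] at the integral of [expR (r * w)]. *)
Lemma Mop_subhomogeneous w c d l x : 0 < c -> (forall s, c <= w s <= d) ->
  measurable_fun setT (w : borelT S -> R) -> 1 <= l ->
  M (fun s => l * w s) x <= l * M w x.
Proof.
move=> c0 wcd mw l1; have l0 : 0 < l := lt_le_trans ltr01 l1.
have lwcd s : l * c <= l * w s <= l * d by rewrite !ler_pM2l.
have intE t v' : measurable_fun setT (v' : borelT S -> R) ->
    (forall s, 0 <= v' s <= t) ->
    (q x).-integrable setT (EFin \o (fun s => expR (r * v' s)) : borelT S -> \bar R).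
  move=> mv' v't; apply: (@bounded_integrable _ _ _ _ _ 1).
    by apply: measurableT_comp => //; exact: measurable_funM.
  move=> s; rewrite ger0_norm ?expR_ge0// -expR0 ler_expR nmulr_rle0//.
  by case/andP: (v't s).
set m := M w x.
rewrite -(ler_nM2l r_lt0) -ler_expR (Mop_expK x lwcd).
have iw : (q x).-integrable setT (EFin \o (fun s => expR (r * w s)) : borelT S -> \bar R).
  apply: (intE d) => // s; case/andP: (wcd s) => cw ->.
  by rewrite (le_trans (ltW c0)).
have ilw : (q x).-integrable setT
    (EFin \o (fun s => expR (r * (l * w s))) : borelT S -> \bar R).
  apply: (intE (l * d)); first exact: measurable_funM.
  move=> s; case/andP: (lwcd s) => cw ->.
  by rewrite (le_trans _ cw)// mulr_ge0// ltW.
set k := expR (r * (l * m)).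
have tangent s : k * (1 - l) + k * l * expR (- (r * m)) * expR (r * w s)
    <= expR (r * (l * w s)).
  have := expR_bernoulli (r * (w s - m)) l1.
  rewrite -(ler_pM2l (expR_gt0 (r * (l * m)))) -expRD.
  rewrite (_ : r * (l * m) + l * (r * (w s - m)) = r * (l * w s)); last by ring.
  rewrite -/k [r * (w s - m)]mulrBr expRD; apply: le_trans.
  by rewrite le_eqVlt; apply/orP; left; apply/eqP; ring.
(* The integral of [expR (r * w)] is [expR (r * m)], so the tangent line integrates to its value [k]
   at the point of contact. *)
have -> : k = \int[q x]_s (k * (1 - l) + k * l * expR (- (r * m)) * expR (r * w s)).
  have ic t : (q x).-integrable setT (EFin \o (fun=> t) : borelT S -> \bar R).
    exact: finite_measure_integrable_cst.
  rewrite RintegralD//; last first.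
    by exact: (integrableZl measurableT _ iw).
  rewrite Rintegral_probability_cst RintegralZl// -(Mop_expK x wcd) -/m.
  by rewrite -mulrA -expRD addNr expR0; ring.
apply: le_Rintegral => //.
have ic := @finite_measure_integrable_cst _ _ _ (q x) setT (k * (1 - l)).
exact: (integrableD measurableT (ic measurableT) (integrableZl measurableT _ iw)).
Qed.

(** Monotonicity and subhomogeneity are combined in the order that applies the latter to the
    measurable function: to [v / l] if [v] is measurable, to [w] otherwise. The range is widened to
    contain the rescaled functions. *)
Lemma Mop_le_scale v w c d l x : 0 < c ->
  (forall s, c <= v s <= d) -> (forall s, c <= w s <= d) ->
  measurable_fun setT (v : borelT S -> R) \/
  measurable_fun setT (w : borelT S -> R) ->
  1 <= l -> (forall s, v s <= l * w s) -> M v x <= l * M w x.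
Proof.
move=> c0 vcd wcd mvw l1 vlw; have l0 : 0 < l := lt_le_trans ltr01 l1.
have d0 : 0 < d by case/andP: (vcd point) => /(lt_le_trans c0) /lt_le_trans; apply.
have cl : c / l <= c by rewrite ler_pdivrMr// ler_peMr// ltW.
have dl : d <= l * d by rewrite ler_peMl// ltW.
have in_big f : (forall s, c <= f s <= d) -> forall s, c / l <= f s <= l * d.
  by move=> fcd s; case/andP: (fcd s) => /(le_trans cl)-> /le_trans->.
case: mvw => [mv|mw].
- have vl s : c / l <= v s / l <= d.
    case/andP: (vcd s) => cv vd; rewrite ler_pM2r ?invr_gt0// cv/=.
    by rewrite ler_pdivrMr// mulrC (le_trans vd).
  have vE : v = (fun s => l * (v s / l)).
    by apply/funext => s; rewrite mulrC divfK ?gt_eqF.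
  rewrite {1}vE (le_trans (Mop_subhomogeneous x _ vl _ l1))//.
  + by rewrite divr_gt0.
  + exact: measurable_funM.
  rewrite ler_pM2l// (@Mop_le _ _ (c / l) d)// => s.
  + by case/andP: (wcd s) => /(le_trans cl)->.
  + by rewrite ler_pdivrMr// mulrC.
- rewrite (le_trans _ (Mop_subhomogeneous x c0 wcd mw l1))//.
  rewrite (@Mop_le _ _ (c / l) (l * d))//; first exact: in_big.
  move=> s; case/andP: (wcd s) => cw wd; rewrite !ler_pM2l// wd.
  by rewrite (le_trans cl)// (le_trans cw)// ler_peMl// (le_trans _ cw)// ltW.
Qed.

End certainty_equivalent.

(** * Maximizers over upper semicontinuous correspondences *)

Section argmax.
Context {R : realType} {A : topologicalType}.
Implicit Types (C D : set A) (g : A -> R).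

Definition argmax C g : set A := [set a | C a /\ forall b, C b -> g b <= g a].

Lemma usc_on_subset C D g : C `<=` D -> usc_on D g -> usc_on C g.
Proof.
move=> CD ug x c Cx gxc; have := ug x c (CD _ Cx) gxc.
by rewrite !near_withinE; apply: filterS => y + /CD; apply.
Qed.

(** Otherwise [g < m] on [C]; around each point [g] stays below a midpoint level, and compactness
    yields one level [c < m] above all of [g], which contradicts the hypothesis. *)
Lemma usc_compact_attained C g m : compact C -> usc_on C g ->
  (forall c, c < m -> exists2 a, C a & c <= g a) -> exists2 a, C a & m <= g a.
Proof.
move=> /compact_near_coveringP cC ug cm; apply: contrapT => h.
have gm a : C a -> g a < m.
  by move=> Ca; rewrite ltNge; apply/negP => mg; apply: h; exists a.
have : \forall c \near m^'-, C `<=` [set a | C a -> g a < c].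
  apply: (cC _ _ (fun c a => C a -> g a < c)) => a Ca.
  have gaM := midf_lt (gm _ Ca).
  have := ug a ((g a + m) / 2) Ca; rewrite gaM.1 near_withinE => /(_ isT) N.
  exists ([set x | C x -> g x < (g a + m) / 2], [set c | (g a + m) / 2 < c]) => /=.
    by split=> //; apply: nbhs_left_gt; exact: gaM.2.
  by move=> [x c] /= [gx cx] Cx; rewrite (lt_trans (gx Cx)).
move=> Nc; near m^'- => c.
have [|a Ca] := cm c; first by near: c; exact: nbhs_left_lt.
rewrite leNgt => /negP; apply; suff : C `<=` [set a | C a -> g a < c].
  by move=> /(_ a Ca); exact.
by near: c.
Unshelve. all: by end_near. Qed.

Lemma argmax_nonempty C g M : compact C -> usc_on C g -> C !=set0 ->
  (forall a, C a -> g a <= M) -> argmax C g !=set0.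
Proof.
move=> cC ug [a0 Ca0] gM; set m := sup (g @` C).
have hs : has_sup (g @` C).
  split; first by exists (g a0), a0.
  by exists M => _ [a Ca <-]; exact: gM.
have [|a Ca ma] := @usc_compact_attained C g m cC ug.
  move=> c cm; have [|_ [a Ca <-] ca] := sup_adherent (eps := m - c) _ hs.
    by rewrite subr_gt0.
  by exists a => //; rewrite ltW// (le_lt_trans _ ca)// subKr.
exists a; split=> // b Cb; apply: le_trans ma.
by apply: ub_le_sup; [case: hs | exists b].
Qed.

(** A cluster point [a] in [C] with [g a < g b] would have a neighbourhood free of maximizers. *)
Lemma compact_argmax C g : compact C -> usc_on C g -> compact (argmax C g).
Proof.
move=> cC ug F PF Fm; have FC : F C by apply: filterS Fm => a [].
have [a [Ca aF]] := cC F PF FC; exists a; split=> //; split=> // b Cb.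
rewrite leNgt; apply/negP => gab.
have := ug a (g b) Ca gab; rewrite near_withinE => N.
have [c [[Cc gc] /(_ Cc)]] := aF _ _ Fm N.
by rewrite ltNge gc.
Qed.

(** Cantor's intersection theorem: the sets generate a proper filter, and a cluster point of it
    belongs to each of them, compact sets being closed here. *)
Lemma nested_compact_nonempty (C : nat -> set A) : hausdorff_space A ->
  (forall n, compact (C n)) -> (forall n, C n !=set0) ->
  (forall n, C n.+1 `<=` C n) -> \bigcap_n C n !=set0.
Proof.
move=> hA cC C0 CS.
have Cnm n m : (n <= m)%N -> C m `<=` C n.
  elim: m => [|m IH]; first by rewrite leqn0 => /eqP->.
  rewrite leq_eqVlt => /predU1P[->//|]; rewrite ltnS => /IH.
  exact: subset_trans (CS m).
pose F : set_system A := filter_from setT C.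
have FF : ProperFilter F.
  apply: filter_from_proper; last by move=> n _; exact: C0.
  apply: filter_from_filter; first by exists 0%N.
  move=> i j _ _; exists (maxn i j) => //; rewrite subsetI.
  by split; apply: Cnm; rewrite ?leq_maxl ?leq_maxr.
have FC n : F (C n) by exists n.
have [a [_ aF]] := cC 0%N F FF (FC 0%N).
exists a => n _; apply: (compact_closed hA (cC n)).
by move=> B Ba; exact: aF.
Qed.

End argmax.

Section correspondence.
Context {R : realType} {S A : ptopologicalType} (K : set (S * A)).
Hypothesis K_usc : usc_corr (section_of K).
Hypothesis K_compact : forall s, compact (section_of K s).

(** A tube lemma. Compactness of the section at [s] makes the neighbourhood [U] of [s] uniform in
    the action; upper semicontinuity then keeps nearby sections inside the open set [W] of actions
    that are good over [U]. *)
Lemma section_near s (P : set (S * A)) :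
  (forall a, K (s, a) -> \forall x \near within K (nbhs (s, a)), P x) ->
  \forall t \near s, forall a, K (t, a) -> P (t, a).
Proof.
move=> NP.
have [U Us UP] : exists2 U, nbhs s U & forall a, K (s, a) ->
    \forall b \near a, forall t, U t -> K (t, b) -> P (t, b).
  pose Q (U : set S) (a : A) := \forall b \near a, forall t, U t -> K (t, b) -> P (t, b).
  have : \forall U \near powerset_filter_from (nbhs s),
      section_of K s `<=` Q U.
    apply: ((compact_near_coveringP _).1 (@K_compact s)) => a Ka.
    have := NP a Ka; rewrite near_withinE => -[[U V] /= [Us Va] UV].
    exists ([set b | \forall c \near b, V c], [set W | W `<=` U]) => /=.
      by split; [exact: nbhs_interior|exact: small_set_sub].
    move=> [b W] /= [Vb WU]; apply: filterS Vb => c Vc t Wt Kt.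
    by apply: UV => //; split=> //; exact: WU.
  move=> NU; near (powerset_filter_from (nbhs s)) => U; exists U.
    by near: U; exact: near_small_set.
  by near: U.
pose W : set A := [set a | \forall b \near a, forall t, U t -> K (t, b) -> P (t, b)].
have oW : open W by rewrite openE => a Wa; exact: nbhs_interior.
have cl : closed [set t | section_of K t `&` ~` W !=set0].
  by apply: K_usc; exact: open_closedC.
have sW : \forall t \near s, ~ (section_of K t `&` ~` W !=set0).
  apply: open_nbhs_nbhs; split; first exact: closed_openC.
  by move=> [a [Ka /= nW]]; apply: nW; exact: UP.
near=> t => a Ka.
have Wa : W a.
  apply: contrapT => nW; suff : ~ (section_of K t `&` ~` W !=set0).
    by apply; exists a.
  by near: t.
have Ut : U t by near: t.
exact: (nbhs_singleton Wa).
Unshelve. all: by end_near. Qed.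

(** The complement is open by the tube lemma: near an action of [D] the value of [g] stays below
    [c], and near any other action [D] is avoided. *)
Lemma closed_section_hit (g : S * A -> R) (D : set A) c : usc_on K g ->
  closed D -> closed [set s | exists a, [/\ K (s, a), D a & c <= g (s, a)]].
Proof.
move=> ug cD; rewrite -[X in closed X]setCK; apply: open_closedC.
rewrite openE => s /= hs.
have : \forall t \near s, forall a, K (t, a) -> ~ (D a /\ c <= g (t, a)).
  apply: (@section_near s [set x | ~ (D x.2 /\ c <= g x)]) => a Ka.
  have [Da|nDa] := pselect (D a).
    have gc : g (s, a) < c.
      by rewrite ltNge; apply/negP => cg; apply: hs; exists a.
    by apply: filterS (ug _ _ Ka gc) => x gx [_]; rewrite leNgt gx.
  apply: cvg_within; exists (setT, ~` D) => /=.
    by split; [exact: filterT|exact: open_nbhs_nbhs (conj (closed_openC cD) nDa)].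
  by move=> [t b] /= [_ nD] [].
by apply: filterS => t h [a [Ka Da cg]]; exact: (h a Ka).
Qed.

End correspondence.

(** * Measurable selection of maximizers *)

Section metric.
Context {R : realType} {X : metricType R}.

Lemma mdist_continuous (x : X) : continuous (mdist x : X -> R).
Proof.
move=> y; apply/cvgrPdist_lt => e e0.
have := nbhsx_ballx y e e0; apply: filterS => z; rewrite ballEmdist/= => yz.
rewrite (le_lt_trans _ yz)// ler_distl.
have h1 := metric_triangle x z y; have h2 := metric_triangle x y z.
by rewrite (metric_sym z y) in h1; apply/andP; split; lra.
Qed.

(** A point of the dense set that is within half of [mdist y z] from [y] is strictly closer to [y]
    than to [z]. *)
Lemma separating_distances (x0 : X) : separable_space X -> exists e : nat -> X,
  forall y z, (forall n, mdist (e n) y = mdist (e n) z) -> y = z.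
Proof.
move=> [D [/countable_injP[f finj] dD]].
(* [f] numbers [D] injectively; an index that numbers no point of [D] receives the harmless default
   [x0]. *)
exists (fun n => if pselect (exists x, D x /\ f x = n) is left h
  then sval (cid h) else x0) => y z eyz.
apply: contrapT => /eqP; rewrite -mdist_gt0 => yz0.
have y20 : 0 < mdist y z / 2 by rewrite divr_gt0.
have [x [/interior_subset yx Dx]] : (ball y (mdist y z / 2))^° `&` D !=set0.
  apply: dD; last exact: open_interior.
  by exists y; exact: nbhsx_ballx.
have := eyz (f x); case: pselect => [h|[]]; last by exists x.
case: cid => t /= [Dt ft].
have -> : t = x by apply: finj; rewrite ?inE.
move: yx; rewrite ballEmdist/= => yx xyz.
have := metric_triangle y x z; rewrite -xyz (metric_sym x y).
by rewrite leNgt => /negP; apply; rewrite [ltRHS]splitr ltrD.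
Qed.

End metric.

Section borel_space_embedding.
Context {R : realType} {T : ptopologicalType} {X : metricType R} (i : T -> X).
Hypothesis i_inj : injective i.
Hypothesis i_open : forall U : set T,
  open U <-> exists2 V : set X, open V & U = i @^-1` V.

Lemma embedding_continuous : continuous i.
Proof. by apply/continuousP => V oV; apply/i_open; exists V. Qed.

Lemma embedding_hausdorff : hausdorff_space T.
Proof.
move=> p q pq; apply: i_inj; apply: metric_hausdorff => U V Up Vq.
have [x [Ux Vx]] := pq _ _ (embedding_continuous Up) (embedding_continuous Vq).
by exists (i x).
Qed.

End borel_space_embedding.

Section selection.
Context {R : realType} {S A : ptopologicalType}.

(** Closed test sets, rather than open ones, keep intersections with compact values compact, so that
    maxima over them are attained. *)
Definition hit_measurable (F : S -> set A) := forall D, closed D ->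
  measurable ([set s | F s `&` D !=set0] : set (borelT S)).

Lemma hit_measurable_argmax (F : S -> set A) (g : S -> A -> R) M :
  (forall s, compact (F s)) -> (forall s, F s !=set0) ->
  (forall s, usc_on (F s) (g s)) -> (forall s a, F s a -> g s a <= M) ->
  (forall D c, closed D ->
     measurable ([set s | exists a, [/\ F s a, D a & c <= g s a]]
                 : set (borelT S))) ->
  hit_measurable (fun s => argmax (F s) (g s)).
Proof.
move=> cF F0 ug gM mg D cD.
pose hit c E : set (borelT S) := [set s | exists a, [/\ F s a, E a & c <= g s a]].
(* A maximizer lies in [D] iff every rational level reached on [F s] is
   reached on [F s `&` D]. *)
suff -> : [set s | argmax (F s) (g s) `&` D !=set0] =
    ~` \bigcup_(c : rat) (hit (ratr c) setT `\` hit (ratr c) D).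
  apply: measurableC; apply: bigcupT_measurable_rat => c.
  by apply: measurableD; apply: mg => //; exact: closedT.
apply/seteqP; split => s /=.
  move=> [a [[Fa ma] Da]] [c _ [[b [Fb _ cb]]]]; apply.
  by exists a; split=> //; rewrite (le_trans cb)// ma.
move=> h; have [a0 [Fa0 ma0]] := argmax_nonempty (cF s) (ug s) (F0 s) (gM s).
have [|||a [Fa Da] ma] := @usc_compact_attained _ _ (F s `&` D) (g s) (g s a0).
- exact: compact_closedI.
- by apply: usc_on_subset (ug s); exact: subIsetl.
- move=> c /rat_in_itvoo[k]; rewrite in_itv/= => /andP[ck kg].
  apply: contrapT => nD; apply: h; exists k => //; split.
    by exists a0; split=> //; exact: ltW.
  move=> [b [Fb Db kb]]; apply: nD; exists b => //.
  by rewrite (le_trans (ltW ck)).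
exists a; split=> //; split=> // b Fb; apply: le_trans ma; exact: ma0.
Qed.

Context (HA : borel_space R A) (K : set (S * A)) (g : S * A -> R) (M : R).
Hypotheses (K_usc : usc_corr (section_of K))
  (K_compact : forall s, compact (section_of K s))
  (K_sections : forall s, section_of K s !=set0).
Hypotheses (g_usc : usc_on K g) (g_le : forall x, K x -> g x <= M).

Lemma usc_on_section s : usc_on (section_of K s) (fun a => g (s, a)).
Proof.
move=> a c Ka gac; have := g_usc Ka gac; rewrite !near_withinE.
move=> [[U V] /= [Us Va] UV]; apply: filterS Va => b Vb Kb.
by apply: (UV (s, b)) => //; split=> //; exact: nbhs_singleton.
Qed.

Lemma hit_measurable_argmax_section :
  hit_measurable (fun s => argmax (section_of K s) (fun a => g (s, a))).
Proof.
apply: (@hit_measurable_argmax _ _ M) => //.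
- exact: usc_on_section.
- by move=> s a Ka; exact: g_le.
- by move=> D c cD; apply: closed_borel; exact: closed_section_hit.
Qed.

(* The maximizers are thinned out by maximizing successively countably many
   continuous functions that separate points; only one point survives. *)
Lemma measurable_argmax_selection : exists f : S -> A, is_selector K f /\
  forall s a, K (s, a) -> g (s, a) <= g (s, f s).
Proof.
have [X [i [_ sX i_inj i_open _]]] := HA.
have hA := embedding_hausdorff i_inj i_open.
have ci := embedding_continuous i_open.
have [e sep_e] := separating_distances (i point) sX.
pose psi n a : R := - mdist (e n) (i a).
have cpsi n : continuous (psi n).
  move=> a; apply: cvgN; apply: continuous_comp; first exact: ci.
  exact: mdist_continuous.
have psi_le n a : psi n a <= 0 by rewrite oppr_le0 mdist_ge0.
have upsi n C : usc_on C (psi n).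
  by apply: continuous_usc_on; exact: continuous_subspaceT.
pose F := fix F n s : set A := if n is m.+1 then argmax (F m s) (psi m)
  else argmax (section_of K s) (fun a => g (s, a)).
have cF n s : compact (F n s).
  elim: n => [|n IH]; apply: compact_argmax => //; exact: usc_on_section.
have F0 n s : F n s !=set0.
  elim: n => [|n IH].
    apply: (@argmax_nonempty _ _ _ _ M) => //; first exact: usc_on_section.
    by move=> a; exact: g_le.
  by apply: (@argmax_nonempty _ _ _ _ 0).
have FS n s : F n.+1 s `<=` F n s by move=> a [].
have hF n : hit_measurable (F n).
  elim: n => [|n IH]; first exact: hit_measurable_argmax_section.
  apply: (@hit_measurable_argmax (F n) (fun=> psi n) 0) => // D c cD.
  have cc : closed (D `&` [set a | c <= psi n a]).
    apply: closedI => //; apply: (@closed_comp _ _ (psi n) [set x | c <= x]).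
      by move=> a _; exact: cpsi.
    exact: closed_ge.
  rewrite [X in measurable X](_ : _ =
    [set s | F n s `&` (D `&` [set a | c <= psi n a]) !=set0]); first exact: IH.
  by apply/seteqP; split=> s [a]; [move=> []|move=> [? []]]; exists a.
have ex_f s := nested_compact_nonempty hA (cF^~ s) (F0^~ s) (FS^~ s).
pose f s := xget point (\bigcap_n F n s).
have fF s n : F n s (f s).
  by rewrite /f; case: xgetP => [a _ /(_ n I)//|nF]; case: (ex_f s) => a /nF.
(* Two survivors both maximize each [psi n], hence are equidistant from every [e n] and coincide. *)
have fE s a : (forall n, F n s a) -> a = f s.
  move=> Fa; apply: i_inj; apply: sep_e => n.
  have [_ h1] := Fa n.+1; have [_ h2] := fF s n.+1.
  apply/eqP; rewrite -eqr_opp eq_le; apply/andP; split.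
    exact: h2 (Fa n).
  exact: h1 (fF s n).
exists f; split; last first.
  by move=> s a Ka; have [_] := fF s 0%N; exact.
split; last by move=> s; have [] := fF s 0%N.
have cmeas D : closed D -> measurable (f @^-1` D : set (borelT S)).
  move=> cD; rewrite [X in measurable X](_ : _ =
    \bigcap_n [set s | F n s `&` D !=set0]).
    by apply: bigcapT_measurable => n; exact: hF.
  apply/seteqP; split=> s /=; first by move=> Df n _; exists (f s).
  (* If every stage meets [D], some survivor lies in [D], and the only survivor is [f s]. *)
  move=> hD; have [||n|n|a FDa] := @nested_compact_nonempty _ (fun n => F n s `&` D).
  - exact: hA.
  - by move=> n; exact: compact_closedI.
  - exact: hD.
  - by move=> a [/FS].
  have <- : a = f s by apply: fE => n; have [] := FDa n I.
  by have [] := FDa 0%N I.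
apply: (@measurability _ _ (borelT S) (borelT A) setT f (@open A) erefl).
move=> _ [U oU <-]; rewrite setTI -[U]setCK preimage_setC.
exact: measurableC (cmeas _ (open_closedC oU)).
Qed.

End selection.

(** * Semicontinuity of the certainty equivalent *)

Section lipschitz_regularization.
Context {R : realType} {T : ptopologicalType} {X : metricType R} (i : T -> X).
Hypothesis i_open : forall U : set T,
  open U <-> exists2 V : set X, open V & U = i @^-1` V.
Context (h : T -> R) (b : R).
Hypothesis h_bounds : forall s, 0 <= h s <= b.
Hypothesis h_lsc : forall s c, c < h s -> \forall t \near s, c < h t.

(** The Pasch-Hausdorff envelope: the largest minorant of [h] that is [n]-Lipschitz for the distance
    pulled back along [i]. *)
Definition lip (n : nat) (s : T) : R :=
  inf [set h t + n%:R * mdist (i s) (i t) | t in setT].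

Lemma lip_le n s t : lip n s <= h t + n%:R * mdist (i s) (i t).
Proof.
apply: ge_inf; last by exists t.
exists 0 => _ [t' _ <-]; rewrite addr_ge0 ?mulr_ge0 ?mdist_ge0//.
by case/andP: (h_bounds t').
Qed.

Lemma le_lip n s c : (forall t, c <= h t + n%:R * mdist (i s) (i t)) ->
  c <= lip n s.
Proof.
move=> hc; apply: lb_le_inf; first by exists (h s + n%:R * mdist (i s) (i s)), s.
by move=> _ [t _ <-].
Qed.

Lemma lip_le_self n s : lip n s <= h s.
Proof. by rewrite (le_trans (lip_le n s s))// mdistxx mulr0 addr0. Qed.

Lemma lip_ge0 n s : 0 <= lip n s.
Proof.
apply: le_lip => t; rewrite addr_ge0 ?mulr_ge0 ?mdist_ge0//.
by case/andP: (h_bounds t).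
Qed.

Lemma lip_nondecreasing s : {homo lip^~ s : m n / (m <= n)%N >-> m <= n}.
Proof.
move=> m n mn; apply: le_lip => t; rewrite (le_trans (lip_le m s t))//.
by rewrite lerD2l ler_wpM2r ?mdist_ge0// ler_nat.
Qed.

Lemma lip_continuous n : continuous (lip n).
Proof.
have lipD s s' : lip n s <= lip n s' + n%:R * mdist (i s) (i s').
  rewrite -lerBlDr; apply: le_lip => t; rewrite lerBlDr.
  rewrite (le_trans (lip_le n s t))// -addrA lerD2l -mulrDr ler_wpM2l//.
  by rewrite addrC metric_triangle.
move=> s; apply/cvgrPdist_lt => e e0.
(* The radius uses [n.+1], since [n] may be zero. *)
have n0 : 0 < n.+1%:R :> R by [].
have : nbhs s (i @^-1` ball (i s) (e / n.+1%:R)).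
  by apply: (embedding_continuous i_open); apply: nbhsx_ballx; rewrite divr_gt0.
apply: filterS => t /=; rewrite ballEmdist/= => st.
have nst : n%:R * mdist (i s) (i t) < e.
  rewrite (@le_lt_trans _ _ (n.+1%:R * mdist (i s) (i t)))//.
    by rewrite ler_wpM2r ?mdist_ge0// ler_nat.
  by rewrite mulrC -ltr_pdivlMr.
have h1 := lipD s t; have h2 := lipD t s; rewrite (metric_sym (i t)) in h2.
by rewrite ltr_distl; apply/andP; split; lra.
Qed.

(** Within distance [d] of [s], semicontinuity keeps [h] above [h s - e / 2]; farther away the
    penalty alone exceeds [h s] once [n] is large. *)
Lemma cvg_lip s : lip n s @[n --> \oo] --> h s.
Proof.
have hb := fun t => andP (h_bounds t).
apply/cvgrPdist_lt => e e0.
have /h_lsc : h s - e / 2 < h s by rewrite ltrBlDr ltrDl divr_gt0.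
rewrite -nbhs_nearE nbhsE => -[U [/i_open[V oV ->] /= Vs] UV].
have := open_nbhs_nbhs (conj oV Vs); rewrite -nbhs_ballE => -[d /= d0 dV].
near=> n.
have nd : h s <= n%:R * d.
  by rewrite -ler_pdivrMr//; near: n; exact: nbhs_infty_ger.
have hsn : h s - e / 2 <= lip n s.
  apply: le_lip => t; have [td|dt] := ltP (mdist (i s) (i t)) d.
    have /UV /= ht : V (i t) by apply: dV; rewrite ballEmdist.
    by rewrite ler_wpDr ?mulr_ge0 ?mdist_ge0// ltW.
  rewrite (@le_trans _ _ (h s))// ?lerBlDr ?lerDl ?divr_ge0 ?(ltW e0)//.
  rewrite (le_trans nd)// ler_wpDl//; first by case: (hb t).
  by rewrite ler_wpM2l.
have := lip_le_self n s; rewrite ltr_distl => ns.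
by apply/andP; split; lra.
Unshelve. all: by end_near. Qed.

Lemma lsc_integral_approx (mu : probability (borelT T) R) c :
  c < \int[mu]_s h s -> exists n, c < \int[mu]_s lip n s.
Proof.
move=> ch; apply: contrapT => /forallNP nc.
have fin_lip n : (\int[mu]_s (lip n s)%:E)%E \is a fin_num.
  apply: (@ge0_bounded_integral_fin_num _ _ _ _ _ b) => s.
  rewrite lip_ge0 (le_trans (lip_le_self n s))//.
  by case/andP: (h_bounds s).
suff : (\int[mu]_s (h s)%:E <= c%:E)%E.
  rewrite -(fineK (ge0_bounded_integral_fin_num mu h_bounds)) lee_fin.
  by rewrite leNgt ch.
have hE : (\int[mu]_s (h s)%:E = \int[mu]_s limn (fun n => (lip n s)%:E))%E.
  apply: eq_integral => s _; apply/esym/cvg_lim => //.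
  by apply: cvg_comp; [exact: cvg_lip|].
have cvg_int : (\int[mu]_s (lip n s)%:E)%E @[n --> \oo] -->
    (\int[mu]_s (h s)%:E)%E.
  rewrite hE; apply: cvg_monotone_convergence => //.
  - move=> n; apply/measurable_EFinP; apply: continuous_borel.
    exact: lip_continuous.
  - by move=> n s _; rewrite lee_fin lip_ge0.
  - by move=> s _ m n mn; rewrite lee_fin lip_nondecreasing.
apply: (cvge_le _ cvg_int); near=> n.
by rewrite -(fineK (fin_lip n)) lee_fin leNgt; apply/negP; exact: nc.
Unshelve. all: by end_near. Qed.

End lipschitz_regularization.

Section feller_semicontinuity.
Context {R : realType} {S A : ptopologicalType} (HS : borel_space R S).
Context (K : set (S * A)) (q : S * A -> probability (borelT S) R) (r : R).
Hypotheses (q_feller : feller K q) (r_lt0 : r < 0).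

(** As [r < 0], [expR (r * v)] is lower semicontinuous. A strict lower bound on its integral is
    already met by some Lipschitz minorant, whose integral is continuous by the Feller property, so
    the bound persists nearby. *)
Lemma Mop_usc v c d : (forall s, c <= v s <= d) -> usc_on setT v ->
  usc_on K (Mop q r v).
Proof.
move=> vcd uv x t Kx Mxt; have [X [i [_ _ i_inj i_open _]]] := HS.
pose h s := expR (r * v s).
have h_bounds s : 0 <= h s <= expR (r * c).
  by rewrite expR_ge0 ler_expR ler_nM2l//; case/andP: (vcd s).
have h_lsc s k : k < h s -> \forall s' \near s, k < h s'.
  have [k0 _|k0 kh] := leP k 0; first by near=> s'; rewrite (le_lt_trans k0)// expR_gt0.
  have vs : v s < r^-1 * ln k.
    by rewrite -(ltr_nM2l r_lt0) mulVKf ?ltr0_neq0// -ltr_expR lnK.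
  have := uv s _ I vs; rewrite near_withinE; apply: filterS => s' /(_ I) vs'.
  by rewrite -[k]lnK// ltr_expR -[ltLHS](mulVKf (ltr0_neq0 r_lt0)) ltr_nM2l.
have := Mxt; rewrite (Mop_ltP q r_lt0 x t vcd).
move=> /(lsc_integral_approx i_open h_bounds h_lsc)[n tn].
have lip_int : {within K, continuous (fun y => \int[q y]_s lip i h n s)}.
  apply: q_feller; first exact: (lip_continuous i_open h_bounds).
  exists (expR (r * c)) => s; rewrite ger0_norm ?(lip_ge0 _ h_bounds)//.
  rewrite (le_trans (lip_le_self _ h_bounds _ _))//.
  by case/andP: (h_bounds s).
have : \forall y \near within K (nbhs x),
    expR (r * t) < \int[q y]_s lip i h n s.
  move/subspace_continuousP : lip_int => /(_ x Kx) lip_int.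
  exact: cvgr_gt lip_int _ tn.
apply: filterS => y ty; rewrite (Mop_ltP q r_lt0 y t vcd) (lt_le_trans ty)//.
apply: (@ge0_le_Rintegral _ _ _ _ _ _ (expR (r * c))) => s.
- exact: (lip_ge0 _ h_bounds).
- exact: (lip_le_self _ h_bounds).
- by case/andP: (h_bounds s).
Unshelve. all: by end_near. Qed.

Lemma Mop_continuous v c d : (forall s, c <= v s <= d) -> continuous v ->
  {within K, continuous (Mop q r v)}.
Proof.
move=> vcd cv; apply/subspace_continuousP => x Kx.
apply: cvgMr; apply: continuous_cvg.
  exact: continuous_ln (exp_integral_gt0 q r_lt0 x vcd).
move: x Kx; apply/subspace_continuousP; apply: q_feller.
  move=> s; apply: continuous_comp; last exact: continuous_expR.
  by apply: cvgMr; exact: cv.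
exists (expR (r * c)) => s; rewrite ger0_norm ?expR_ge0// ler_expR ler_nM2l//.
by case/andP: (vcd s).
Qed.

End feller_semicontinuity.

(** * The value function and policies *)

Lemma stationary_is_policy {S A : ptopologicalType} (K : set (S * A))
  (f : S -> A) : is_selector K f -> is_policy K (stationary f).
Proof.
move=> [mf fK] n; split; last by move=> h _; exact: fK.
have mcur : measurable_fun setT (@current S A n : borelT (hist S A n) -> borelT S).
  apply: (@measurability _ _ (borelT (hist S A n)) (borelT S) setT _ (@open S) erefl).
  move=> _ [U oU <-]; rewrite setTI; apply: open_borel.
  move: U oU; apply/continuousP.
  by case: n => [|n] h //=; exact: cvg_snd.
by apply: measurable_funTS; exact: measurableT_comp mf mcur.
Qed.

Lemma usc_lsc_continuous {R : realType} {S : topologicalType} (f : S -> R) :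
  usc_on setT f -> (forall s c, c < f s -> \forall t \near s, c < f t) ->
  continuous f.
Proof.
move=> uf lf s; apply/cvgrPdist_lt => e e0.
have h1 : f s - e < f s by rewrite ltrBlDr ltrDl.
have h2 : f s < f s + e by rewrite ltrDl.
have := uf s _ I h2; rewrite near_withinE; apply: filterS2 (lf s _ h1) => t l1.
by move=> /(_ I) l2; rewrite ltr_distl; apply/andP; split; lra.
Qed.

Section dynamic_programming.
Context {R : realType} {S A : ptopologicalType} (HS : borel_space R S).
Context (K : set (S * A)) (q : S * A -> probability (borelT S) R)
  (u : S * A -> R) (beta r p b0 b1 eps B : R).
Hypotheses (K_sections : forall s, section_of K s !=set0)
  (b0_gt0 : 0 < b0) (u_bounds : forall x, K x -> b0 <= u x <= b1)
  (beta_bounds : 0 <= beta < 1) (r_lt0 : r < 0)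
  (p_lt1 : p < 1) (p_neq0 : p <> 0)
  (eps_gt0 : 0 < eps) (eps_b0 : eps <= b0) (b1_B : b1 <= B)
  (final_bounds : forall x, K x -> eps <= (1 - beta) `^ p^-1 * u x <= B).
Local Notation H := (Hop q u beta r p).
Local Notation T := (Top K q u beta r p).
Local Notation agg := (aggregator beta p).
Implicit Types (v w : S -> R) (s : S) (a : A) (l : R).

Definition in_range v := forall s, eps <= v s <= B.

Let u_gt0 x : K x -> 0 < u x.
Proof. by case/u_bounds/andP => + _; apply: lt_le_trans. Qed.

Let in_range_gt0 v s : in_range v -> 0 < v s.
Proof. by move=> /(_ s)/andP[+ _]; apply: lt_le_trans. Qed.

Let Mop_gt0 v x : in_range v -> 0 < Mop q r v x.
Proof.
move=> vr; have /andP[+ _] := Mop_bounds q r_lt0 x vr.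
exact: lt_le_trans.
Qed.

Let eps_le_B : eps <= B.
Proof.
have [a Ka] := K_sections point.
by case/andP: (final_bounds Ka); exact: le_trans.
Qed.

Lemma Hop_bounds s a v : K (s, a) -> in_range v -> eps <= H s a v <= B.
Proof.
move=> Ka vr; apply: aggregator_bounds => //; last exact: Mop_bounds.
have /andP[b0u ub1] := u_bounds Ka.
by rewrite (le_trans eps_b0 b0u) (le_trans ub1 b1_B).
Qed.

Lemma Hop_le s a v w : K (s, a) -> in_range v -> in_range w ->
  (forall s, v s <= w s) -> H s a v <= H s a w.
Proof.
move=> Ka vr wr vw; apply: aggregator_le => //; first exact: u_gt0.
  exact: Mop_gt0.
exact: Mop_le.
Qed.

(** By continuity the aggregator stays below [c] when both arguments grow by a small [e];
    semicontinuity bounds both arguments by these shifted values, and monotonicity concludes. *)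
Lemma Hop_usc v : feller K q -> usc_on K u -> in_range v -> usc_on setT v ->
  usc_on K (fun x => H x.1 x.2 v).
Proof.
move=> qf uu vr uv [s a] c Ka /= Hc.
have ux0 := u_gt0 Ka; have Mx0 := @Mop_gt0 v (s, a) vr.
have : \forall e \near 0^'+, agg (u (s, a) + e) (Mop q r v (s, a) + e) < c.
  have shift (z : R) : z + e @[e --> 0^'+] --> z.
    rewrite -[X in _ --> X]addr0; apply: cvgD; first exact: cvg_cst.
    exact: cvg_at_right_filter.
  apply: (cvgr_lt _ _ _ Hc).
  by apply: cvg_aggregator => //; exact: shift.
move=> Ne; near (0 : R)^'+ => e.
have e0 : 0 < e by near: e; exact: nbhs_right_gt.
have aggc : agg (u (s, a) + e) (Mop q r v (s, a) + e) < c by near: e.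
have ue : \forall x \near within K (nbhs (s, a)), u x < u (s, a) + e.
  by apply: uu => //; rewrite ltrDl.
have Me : \forall x \near within K (nbhs (s, a)),
    Mop q r v x < Mop q r v (s, a) + e.
  by apply: (Mop_usc HS qf r_lt0 vr uv) => //; rewrite ltrDl.
move: ue Me; rewrite !near_withinE; apply: filterS2 => -[t b] ut Mt Kb.
rewrite (le_lt_trans _ aggc)//; apply: aggregator_le => //.
- exact: u_gt0.
- exact: ltW (ut Kb).
- exact: Mop_gt0.
- exact: ltW (Mt Kb).
Unshelve. all: by end_near. Qed.

Lemma Hop_continuous v : feller K q -> {within K, continuous u} ->
  in_range v -> continuous v -> {within K, continuous (fun x => H x.1 x.2 v)}.
Proof.
move=> qf /subspace_continuousP cu vr cv.
have /subspace_continuousP cM := Mop_continuous qf r_lt0 vr cv.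
have -> : (fun x => H x.1 x.2 v) = (fun x => agg (u x) (Mop q r v x)).
  by apply/funext => -[].
apply/subspace_continuousP => x Kx.
exact: (cvg_aggregator beta_bounds (u_gt0 Kx) (Mop_gt0 x vr) (cu x Kx) (cM x Kx)).
Qed.

(** * Contraction of ratios *)

Section contraction.
Context (k : R).
Hypothesis k_bounds : 0 <= k < 1.
Hypothesis agg_contract : forall x y l, b0 <= x <= b1 -> eps <= y <= B ->
  1 <= l -> agg x (l * y) <= (1 + k * (l - 1)) * agg x y.

Lemma Hop_contract s a v w l : K (s, a) -> in_range v -> in_range w ->
  measurable_fun setT (v : borelT S -> R) \/
  measurable_fun setT (w : borelT S -> R) ->
  1 <= l -> (forall s, v s <= l * w s) ->
  H s a v <= (1 + k * (l - 1)) * H s a w.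
Proof.
move=> Ka vr wr mvw l1 vw.
apply: le_trans (agg_contract (u_bounds Ka) (Mop_bounds q r_lt0 (s, a) wr) l1).
apply: aggregator_le => //; [exact: u_gt0|exact: Mop_gt0|].
exact: (Mop_le_scale q r_lt0 _ eps_gt0).
Qed.

(** The [n]-th iterate of [l |-> 1 + k * (l - 1)] from [B / eps], which bounds the ratio of any two
    functions with values in [[eps, B]]. *)
Definition ratio n : R := 1 + k ^+ n * (B / eps - 1).

Lemma ratio0 : ratio 0 = B / eps.
Proof. by rewrite /ratio expr0 mul1r addrC subrK. Qed.

Lemma ratioS n : ratio n.+1 = 1 + k * (ratio n - 1).
Proof. by rewrite /ratio addrAC subrr add0r exprS mulrA. Qed.

Lemma ratio_ge1 n : 1 <= ratio n.
Proof.
have k0 : 0 <= k by case/andP: k_bounds.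
by rewrite lerDl mulr_ge0 ?exprn_ge0// subr_ge0 ler_pdivlMr// mul1r.
Qed.

Lemma cvg_ratio x : ratio n * x @[n --> \oo] --> x.
Proof.
have [k0 k1] := andP k_bounds.
rewrite -[X in _ --> X]mul1r; apply: cvgMl.
rewrite -[X in _ --> X]addr0; apply: cvgD; first exact: cvg_cst.
rewrite -[X in _ --> X](mul0r (B / eps - 1)); apply: cvgMl.
by apply: cvg_expr; rewrite ger0_norm.
Qed.

Lemma range_le_ratio0 x y : x <= B -> eps <= y -> x <= ratio 0 * y.
Proof.
move=> xB ey; rewrite ratio0 (le_trans xB)// mulrAC ler_pdivlMr//.
by rewrite ler_wpM2l// (le_trans _ eps_le_B)// ltW.
Qed.

(** * Value iteration and its fixed point *)

Section value.
Hypotheses (K_usc : usc_corr (section_of K))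
  (K_compact : forall s, compact (section_of K s))
  (u_usc : usc_on K u) (q_feller : feller K q).

Lemma Hop_le_Top s a v : in_range v -> K (s, a) -> H s a v <= T v s.
Proof.
move=> vr Ka; apply: ub_le_sup; last by exists a.
by exists B => _ [a' Ka' <-]; case/andP: (Hop_bounds Ka' vr).
Qed.

Lemma Top_le_ub s v c : (forall a, K (s, a) -> H s a v <= c) -> T v s <= c.
Proof.
move=> Hc; apply: ge_sup => [|_ [a Ka <-]]; last exact: Hc.
by have [a Ka] := K_sections s; exists (H s a v), a.
Qed.

Lemma Top_attained s v : in_range v -> usc_on setT v ->
  exists2 a, K (s, a) & T v s = H s a v.
Proof.
move=> vr uv; have gu := Hop_usc q_feller u_usc vr uv.
have [||||a [Ka ma]] :=
    @argmax_nonempty _ _ (section_of K s) (fun a => H s a v) B.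
- exact: K_compact.
- exact: (usc_on_section gu).
- exact: K_sections.
- by move=> a Ka; case/andP: (Hop_bounds Ka vr).
exists a => //; apply/eqP; rewrite eq_le Hop_le_Top// andbT.
by apply: Top_le_ub => a' Ka'; exact: (ma a').
Qed.

Lemma Top_in_range v : in_range v -> in_range (T v).
Proof.
move=> vr s; apply/andP; split.
  have [a Ka] := K_sections s; apply: le_trans (Hop_le_Top vr Ka).
  by case/andP: (Hop_bounds Ka vr).
by apply: Top_le_ub => a Ka; case/andP: (Hop_bounds Ka vr).
Qed.

Lemma Top_usc v : in_range v -> usc_on setT v -> usc_on setT (T v).
Proof.
move=> vr uv s c _ Tc; rewrite near_withinE.
have := section_near K_usc K_compact (s := s) (P := [set x | H x.1 x.2 v < c]).
move=> N; have {}N := N (fun a Ka =>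
  Hop_usc q_feller u_usc vr uv Ka (le_lt_trans (Hop_le_Top vr Ka) Tc)).
(* The supremum is attained, so the strict inequality survives it. *)
apply: filterS N => t Ht _; have [a Ka ->] := Top_attained t vr uv.
exact: Ht.
Qed.

Lemma Top_le v w : in_range v -> in_range w -> (forall s, v s <= w s) ->
  forall s, T v s <= T w s.
Proof.
move=> vr wr vw s; apply: Top_le_ub => a Ka.
by apply: le_trans (Hop_le_Top wr Ka); exact: Hop_le.
Qed.

Lemma Top_contract v w l : in_range v -> in_range w ->
  measurable_fun setT (v : borelT S -> R) ->
  1 <= l -> (forall s, v s <= l * w s) ->
  forall s, T v s <= (1 + k * (l - 1)) * T w s.
Proof.
move=> vr wr mv l1 vw s; apply: Top_le_ub => a Ka.
apply: le_trans (Hop_contract Ka vr wr (or_introl mv) l1 vw) _.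
have k0 : 0 <= k by case/andP: k_bounds.
by rewrite ler_wpM2l ?Hop_le_Top// addr_ge0// mulr_ge0// subr_ge0.
Qed.

(** Starting at the upper end of the range makes the sequence decreasing, and semicontinuity then
    passes to its infimum. *)
Definition iterate n : S -> R := iter n T (fun=> B).

Lemma iterate_in_range n : in_range (iterate n).
Proof.
by elim: n => [s|n IH] /=; [rewrite lexx eps_le_B|exact: Top_in_range].
Qed.

Lemma iterate_usc n : usc_on setT (iterate n).
Proof.
elim: n => [x c _ Bc|n IH]; last by apply: Top_usc => //; exact: iterate_in_range.
by apply: nearW.
Qed.

Lemma iterate_decr n s : iterate n.+1 s <= iterate n s.
Proof.
elim: n s => [|n IH] s; first by case/andP: (iterate_in_range 1 s).
exact: (Top_le (iterate_in_range n.+1) (iterate_in_range n) IH).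
Qed.

(** Each application of [Top] improves the initial ratio [B / eps] by one step. The bound is uniform
    in [m], so it passes to the infimum. *)
Lemma iterate_le_ratio n m s : iterate n s <= ratio n * iterate (n + m) s.
Proof.
elim: n s => [|n IH] s.
  apply: range_le_ratio0; first by case/andP: (iterate_in_range 0 s).
  by case/andP: (iterate_in_range (0 + m) s).
rewrite ratioS addSn; apply: Top_contract => //.
- exact: iterate_in_range.
- exact: iterate_in_range.
- apply: usc_borel; exact: iterate_usc.
- exact: ratio_ge1.
Qed.

Definition value s : R := inf [set iterate n s | n in setT].

Lemma value_le_iterate n s : value s <= iterate n s.
Proof.
apply: ge_inf; last by exists n.
by exists eps => _ [m _ <-]; case/andP: (iterate_in_range m s).
Qed.

Lemma le_value c s : (forall n, c <= iterate n s) -> c <= value s.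
Proof.
move=> h; apply: lb_le_inf; first by exists (iterate 0 s), 0%N.
by move=> _ [n _ <-].
Qed.

Lemma value_in_range : in_range value.
Proof.
move=> s; apply/andP; split; last exact: (value_le_iterate 0 s).
by apply: le_value => n; case/andP: (iterate_in_range n s).
Qed.

Lemma iterate_le_value n s : iterate n s <= ratio n * value s.
Proof.
have r0 : 0 < ratio n := lt_le_trans ltr01 (ratio_ge1 n).
rewrite -ler_pdivrMl// mulrC; apply: le_value => m.
rewrite ler_pdivrMr// mulrC.
have [nm|mn] := leqP n m; first by rewrite -(subnKC nm) iterate_le_ratio.
apply: (@le_trans _ _ (iterate m s)).
  rewrite -(subnKC (ltnW mn)); elim: (n - m)%N => [|j IH]; first by rewrite addn0.
  by rewrite addnS (le_trans (iterate_decr _ _)).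
rewrite ler_peMl ?ratio_ge1// (le_trans (ltW eps_gt0))//.
by case/andP: (iterate_in_range m s).
Qed.

Lemma value_usc : usc_on setT value.
Proof.
move=> s c _ vc.
have [n nc] : exists n, iterate n s < c.
  apply: contrapT => /forallNP h; move: vc; rewrite ltNge => /negP; apply.
  by apply: le_value => n; rewrite leNgt; apply/negP; exact: h.
apply: filterS (iterate_usc I nc) => t tc.
exact: le_lt_trans (value_le_iterate n t) tc.
Qed.

(** Monotonicity puts [T value] below every iterate. Conversely [value] is at most
    [ratio n.+1 * T value], and the ratio tends to 1. *)
Lemma value_fixpoint s : value s = T value s.
Proof.
apply/eqP; rewrite eq_le; apply/andP; split; last first.
  apply: le_value => -[|n]; first by case/andP: (Top_in_range value_in_range s).
  apply: Top_le; [exact: value_in_range|exact: iterate_in_range|].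
  exact: value_le_iterate.
have cv : ratio n.+1 * T value s @[n --> \oo] --> T value s.
  by have := @cvg_ratio (T value s); rewrite -cvg_shiftS.
rewrite -(cvg_lim _ cv)//; apply: limr_ge; first exact: cvgP cv.
apply: nearW => n; apply: le_trans (value_le_iterate n.+1 s) _.
rewrite ratioS; apply: Top_contract.
- exact: iterate_in_range.
- exact: value_in_range.
- apply: usc_borel; exact: iterate_usc.
- exact: ratio_ge1.
- exact: iterate_le_value.
Qed.

(** * Upper bound for arbitrary policies *)

Section policies.
Context (pi : forall n, hist S A n -> A).
Hypothesis pi_sections : forall n (h : hist S A n), admissible K h ->
  K (current h, pi h).

Lemma Vrec_in_range d n (h : hist S A n) : admissible K h ->
  eps <= Vrec q u beta r p pi d h <= B.
Proof.
elim: d n h => [|d IH] n h hK /=; first exact/final_bounds/pi_sections.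
apply: Hop_bounds; first exact: pi_sections.
by move=> s; apply: IH; split=> //; exact: pi_sections.
Qed.

(** Each stage before the last costs one use of [Hop_contract], where the measurability comes from
    [value] alone; the fixed point equation absorbs the choice of action. *)
Lemma Vrec_le_value d n (h : hist S A n) : admissible K h ->
  Vrec q u beta r p pi d h <= ratio d * value (current h).
Proof.
elim: d n h => [|d IH] n h hK.
  apply: range_le_ratio0; first by case/andP: (Vrec_in_range 0 hK).
  by case/andP: (value_in_range (current h)).
have Kpi := pi_sections hK.
have hK' s : admissible K ((h, pi h, s) : hist S A n.+1) by split.
apply: (@le_trans _ _ (ratio d.+1 * H (current h) (pi h) value)).
  rewrite ratioS; apply: Hop_contract => //.
  - by move=> s; exact: Vrec_in_range.
  - exact: value_in_range.
  - by right; apply: usc_borel; exact: value_usc.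
  - exact: ratio_ge1.
  - by move=> s; exact: IH.
rewrite value_fixpoint ler_wpM2l ?Hop_le_Top//; last exact: value_in_range.
exact: le_trans ler01 (ratio_ge1 _).
Qed.

Lemma utility_le_value s : utility q u beta r p pi s <= value s.
Proof.
(* [lim] is 0 on a divergent sequence, so convergence is not an issue here. *)
have [cU|/dvgP dU] := pselect (cvgn (fun n => Un q u beta r p pi n s)); last first.
  rewrite /utility dU; exact: ltW (in_range_gt0 _ value_in_range).
have cv := @cvg_ratio (value s).
move: cU => /cvg_ex[l cl]; rewrite /utility (cvg_lim _ cl)//.
(* After the shift, the index [n] counts the stages that remain after the first. *)
move: cl; rewrite -cvg_shiftS => cl.
rewrite -(cvg_lim _ cl)// -(cvg_lim _ cv)//.
apply: ler_lim; [exact: cvgP cl|exact: cvgP cv|apply: nearW => n].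
exact: (@Vrec_le_value n 0 s).
Qed.

End policies.

(** * Utility of a maximizing stationary policy *)

Section stationary_policy.
Context (f : S -> A).
Hypotheses (f_sections : forall s, K (s, f s))
  (f_argmax : forall s, value s = H s (f s) value).

Let pi_sections n (h : hist S A n) : admissible K h ->
  K (current h, stationary f h).
Proof. by []. Qed.

(** The roles are exchanged with respect to [Vrec_le_value]: [f] attains the maximum, so [value]
    unfolds along the policy itself. *)
Lemma value_le_Vrec_stationary d n (h : hist S A n) : admissible K h ->
  value (current h) <= ratio d * Vrec q u beta r p (stationary f) d h.
Proof.
elim: d n h => [|d IH] n h hK.
  apply: range_le_ratio0; first by case/andP: (value_in_range (current h)).
  by case/andP: (Vrec_in_range pi_sections 0 hK).
have hK' s : admissible K ((h, stationary f h, s) : hist S A n.+1) by split.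
rewrite ratioS f_argmax; apply: Hop_contract => //.
- exact: value_in_range.
- by move=> s; exact: (Vrec_in_range pi_sections).
- by left; apply: usc_borel; exact: value_usc.
- exact: ratio_ge1.
- by move=> s; exact: (IH n.+1 ((h, stationary f h, s) : hist S A n.+1) (hK' s)).
Qed.

(** The finite-horizon utilities are squeezed between [value] divided and multiplied by [ratio n],
    which also proves their convergence. *)
Lemma utility_stationary s : utility q u beta r p (stationary f) s = value s.
Proof.
apply/cvg_lim => //; rewrite -cvg_shiftS.
have cinv : (ratio n)^-1 * value s @[n --> \oo] --> value s.
  rewrite -[X in _ --> X]mul1r; apply: cvgMl.
  rewrite -[X in _ --> X]invr1; apply: cvgV; first exact: oner_neq0.
  have := @cvg_ratio 1; rewrite (_ : (fun n => ratio n * 1) = ratio)//.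
  by apply/funext => n; rewrite mulr1.
apply: (squeeze_cvgr _ cinv (@cvg_ratio (value s))); apply: nearW => n.
apply/andP; split; last exact: (@Vrec_le_value _ pi_sections n 0 s).
rewrite ler_pdivrMl ?(lt_le_trans ltr01 (ratio_ge1 n))//.
exact: (@value_le_Vrec_stationary n 0 s).
Qed.

End stationary_policy.

(** * Continuity of the value function *)

Section continuity.
Hypotheses (K_lsc : lsc_corr (section_of K)) (u_cont : {within K, continuous u}).

(** Only lower semicontinuity is new: by lower semicontinuity of the sections, a maximizer at [s]
    has nearby feasible actions at nearby states. *)
Lemma Top_continuous v : in_range v -> continuous v -> continuous (T v).
Proof.
move=> vr cv.
have uv : usc_on setT v by apply: continuous_usc_on; exact: continuous_subspaceT.
apply: usc_lsc_continuous; first exact: Top_usc.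
move=> s c; have [a Ka ->] := Top_attained s vr uv => cH.
have /subspace_continuousP/(_ (s, a) Ka) := Hop_continuous q_feller u_cont vr cv.
move=> /cvgr_gt/(_ c cH); rewrite near_withinE => -[[U V] /= [Us Va] UV].
have sV : [set t | section_of K t `&` V^° !=set0] s.
  by exists a; split=> //; exact: nbhs_singleton (nbhs_interior Va).
have oV : open [set t | section_of K t `&` V^° !=set0].
  by apply: K_lsc; exact: open_interior.
have := open_nbhs_nbhs (conj oV sV).
apply: filterS2 Us => t Ut [b [Kb /interior_subset Vb]].
by apply: lt_le_trans (Hop_le_Top vr Kb); exact: (UV (t, b)).
Qed.

Lemma iterate_continuous n : continuous (iterate n).
Proof.
elim: n => [|n IH]; first exact: cst_continuous.
exact: Top_continuous (iterate_in_range n) IH.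
Qed.

(** The ratio bound plays the part of uniform convergence: a lower bound [ratio n * c] on a
    continuous iterate holds near [s] and gives [c] for [value]. *)
Lemma value_continuous : continuous value.
Proof.
apply: usc_lsc_continuous; first exact: value_usc.
move=> s c cs.
have : \forall n \near \oo, ratio n * c < value s.
  exact: cvgr_lt (@cvg_ratio c) _ cs.
move=> -[n _ /(_ n (leqnn n)) /= nc].
have := @iterate_continuous n s.
have ns : ratio n * c < iterate n s := lt_le_trans nc (value_le_iterate n s).
move=> /cvgr_gt/(_ _ ns); apply: filterS => t nt.
have r0 : 0 < ratio n := lt_le_trans ltr01 (ratio_ge1 n).
by rewrite -(ltr_pM2l r0) (lt_le_trans nt)// iterate_le_value.
Qed.

End continuity.

End value.
End contraction.

(** Continuity is kept as an implication so that one selector serves both sets of conditions. *)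
Lemma optimal_stationary_policy : borel_space R A -> condU K q u ->
  exists f : S -> A,
    let U := utility q u beta r p (stationary f) in
    [/\ is_selector K f, optimal K q u beta r p (stationary f),
        forall s, U s = T U s /\ T U s = H s (f s) U,
        classU eps B U
      & lsc_corr (section_of K) -> {within K, continuous u} -> continuous U].
Proof.
move=> HA [[Kc Ku] uu qf].
have [k kb kc] := aggregator_subhomogeneous beta_bounds p_lt1 p_neq0 b1 B
  b0_gt0 eps_gt0.
have Vr := value_in_range; have Vu := value_usc Ku Kc uu qf.
have VT := value_fixpoint kb kc Ku Kc uu qf.
have Hle x : K x -> H x.1 x.2 value <= B.
  by case: x => s a Ka; case/andP: (Hop_bounds Ka Vr).
have [f [fsel fmax]] :=
  measurable_argmax_selection HA Ku Kc K_sections (Hop_usc qf uu Vr Vu) Hle.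
have [fmeas fK] := fsel.
have TH s : T value s = H s (f s) value.
  apply/eqP; rewrite eq_le Hop_le_Top ?andbT//; last exact: fK.
  by apply: Top_le_ub => a; exact: fmax.
have VH s : value s = H s (f s) value by rewrite VT TH.
have UE : utility q u beta r p (stationary f) = value.
  by apply/funext; exact: (utility_stationary kb kc Ku Kc uu qf fK VH).
exists f; rewrite /= UE; split=> //.
- split; first exact: stationary_is_policy.
  move=> pi piP s; rewrite UE; apply: (utility_le_value kb kc Ku Kc uu qf) => n.
  by case: (piP n).
- move=> Kl cu; exact: (value_continuous kb kc Ku Kc uu qf Kl cu).
Qed.

End dynamic_programming.

Theorem theorem6 (R : realType) (S A : ptopologicalType)
    (HS : borel_space R S) (HA : borel_space R A)
    (K : set (S * A))
    (K_borel : measurable (K : set (borelT (S * A)%type)))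
    (K_nonempty : K !=set0)
    (K_sections : forall s, section_of K s !=set0)
    (q : S * A -> probability (borelT S) R)
    (q_transition : transition_probability K q)
    (u : S * A -> R)
    (u_measurable : measurable_fun (K : set (borelT (S * A)%type))
                      (u : borelT (S * A)%type -> R))
    (b0 b1 : R) (b0_gt0 : 0 < b0) (b01 : b0 < b1)
    (u_bounds : forall s a, K (s, a) -> b0 <= u (s, a) <= b1)
    (beta r p : R) (beta_bounds : 0 <= beta < 1) (r_lt0 : r < 0)
    (p_lt1 : p < 1) (p_neq0 : p <> 0)
    (eps B : R) (eps_gt0 : 0 < eps) (epsB : eps < B)
    (epsB_neg : p < 0 -> eps <= b0 /\ (1 - beta) `^ p^-1 * b1 <= B)
    (epsB_pos : 0 < p -> eps <= (1 - beta) `^ p^-1 * b0 /\ b1 <= B)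
    (conditions : condU K q u \/ condC K q u) :
  exists f : S -> A,
    let U := utility q u beta r p (stationary f) in
    [/\ is_selector K f,
        optimal K q u beta r p (stationary f),
        forall s,
          [/\ U s = Top K q u beta r p U s,
              Top K q u beta r p U s = Tsel q u beta r p f U s
            & Tsel q u beta r p f U s = Hop q u beta r p s (f s) U],
        (condU K q u -> classU eps B U)
      & (condC K q u -> classC eps B U)].
Proof.
have cU : condU K q u.
  case: conditions => // -[[Kc [Ku _]] cu qf].
  by split=> //; exact: continuous_usc_on.
have u_bounds' x : K x -> b0 <= u x <= b1 by case: x => s a; exact: u_bounds.
set c0 := (1 - beta) `^ p^-1 in epsB_neg epsB_pos.
have c0_gt0 : 0 < c0 by rewrite powR_gt0// subr_gt0; case/andP: beta_bounds.
have b1_gt0 : 0 < b1 := lt_trans b0_gt0 b01.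
have c0_01 : 0 < 1 - beta <= 1.
  by case/andP: beta_bounds => h0 h1; rewrite subr_gt0 h1 gerBl.
have c0_neg : p < 0 -> 1 <= c0.
  by move=> p0; rewrite -(powRr0 (1 - beta)) ger_powR// invr_le0 ltW.
have c0_pos : 0 < p -> c0 <= 1.
  by move=> p0; rewrite -(powRr0 (1 - beta)) ger_powR// invr_ge0 ltW.
(* Whether [c0] is at least or at most 1 depends on the sign of [p]; in both cases the weaker two of
   the four bounds follow from the given ones. *)
have [eps_b0 b1_B c0_eps c0_B] : [/\ eps <= b0, b1 <= B, eps <= c0 * b0 & c0 * b1 <= B].
  have [p0|p0|/esym//] := ltgtP 0 p.
    have [e1 e2] := epsB_pos p0; have c01 := c0_pos p0.
    split=> //; first by rewrite (le_trans e1)// ger_pMl.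
    by rewrite (le_trans _ e2)// ger_pMl.
  have [e1 e2] := epsB_neg p0; have c01 := c0_neg p0.
  split=> //; first by rewrite (le_trans _ e2)// ler_pMl.
  by rewrite (le_trans e1)// ler_pMl.
have final_bounds x : K x -> eps <= c0 * u x <= B.
  move=> /u_bounds'/andP[h0 h1]; rewrite (le_trans c0_eps) ?ler_pM2l//=.
  by rewrite (le_trans _ c0_B)// ler_pM2l.
have [f [fsel fopt fix_f Uusc Ucont]] := optimal_stationary_policy HS K_sections
  b0_gt0 u_bounds' beta_bounds r_lt0 p_lt1 p_neq0 eps_gt0 eps_b0 b1_B
  final_bounds HA cU.
exists f; split=> //; first by move=> s; have [] := fix_f s.
move=> [[_ [_ Kl]] cu _]; split; first by case: Uusc.
exact: Ucont.
Qed.
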